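(* Let $(\mathbb F,\star)\in\{(\mathbb C,* ),(\mathbb R,\top)\}$ and let $E,Q\in\mathbb F^{m,n}$ be such that $E^\star Q=Q^\star E$. Then there exist a unitary (real orthogonal if $\mathbb F=\mathbb R$) matrix $U\in\mathbb F^{m,m}$ and a nonsingular matrix $X\in\mathbb F^{n,n}$ such that $$UEX=\begin{bmatrix}E_{11}&E_{12}&0\\0&E_{22}&0\end{bmatrix}\quad\text{and}\quad UQX=\begin{bmatrix}Q_{11}&Q_{12}&0\\0&Q_{22}&0\end{bmatrix}$$ (partitioned conformably) and the following statements hold. (i) $E_{11},Q_{11}\in\mathbb F^{n_1,n_1}$ are diagonal, real and satisfy $E_{11}^2+Q_{11}^2=I_{n_1}$. Furthermore, $U$ and $X$ can be chosen such that one of the matrices $E_{11}$ and $Q_{11}$ is nonnegative and if, in addition, $E^\star Q\ge0$, then $U,X$ can be chosen such that both $E_{11}$ and $Q_{11}$ are nonnegative. (ii) $Q_{22},E_{22}\in\mathbb F^{m_2,n_2}$, with $m_2=m-n_1>n_2$ (or $m_2=n_2=0$), are such that $\lambda E_{22}-Q_{22}$ is singular having left singular blocks (blocks of the form $\mathcal L_{\eta}^\top$) only in its Kronecker canonical form. (iii) $\ker(E_{22})\subseteq\ker(E_{12})$ and $\ker(Q_{22})\subseteq\ker(Q_{12})$. (iv) The pencil $\lambda E-Q$ has the same Kronecker canonical form as $$\lambda\begin{bmatrix}E_{11}&0&0\\0&E_{22}&0\end{bmatrix}-\begin{bmatrix}Q_{11}&0&0\\0&Q_{22}&0\end{bmatrix}.$$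 In particular, the regular part of $\lambda E-Q$ is given by $\lambda E_{11}-Q_{11}$, the left minimal indices of $\lambda E-Q$ coincide with those of $\lambda E_{22}-Q_{22}$, and $\lambda E-Q$ has exactly $n-n_1-n_2$ right minimal indices, which are all zero.
   Context: $*$ is conjugate transpose, $\top$ is transpose; $W\ge0$ means Hermitian (real symmetric) positive semidefinite; a real diagonal matrix is nonnegative if its diagonal entries are $\ge0$. The Kronecker canonical form of a pencil is block diagonal with blocks $\mathcal L_\epsilon=\lambda[I_\epsilon\ 0]-[0\ I_\epsilon]$ of size $\epsilon\times(\epsilon+1)$ (right minimal indices $\epsilon\ge0$), $\mathcal L_\eta^\top$ of size $(\eta+1)\times\eta$ (left minimal indices $\eta\ge0$; $\eta=0$ is a zero row), Jordan blocks of finite eigenvalues, and blocks $\lambda N-I$ with $N$ a nilpotent Jordan block (eigenvalue $\infty$). The regular part consists of the last two kinds of blocks (up to equivalence). Blocks may have zero rows or columns. *)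

(* Defs.v *)
From HB Require Import structures.
From mathcomp Require Import all_boot all_order all_algebra.
From mathcomp Require Import complex.
From mathcomp Require Import reals.

Set Implicit Arguments.
Unset Strict Implicit.
Unset Printing Implicit Defensive.

Import Order.TTheory GRing.Theory Num.Theory.
Local Open Scope ring_scope.
Local Open Scope complex_scope.

Variant ground := RealGround | ComplexGround.

Definition ground_field (R : realType) (k : ground) : numFieldType :=
  match k with RealGround => R | ComplexGround => R[i] end.

Definition conj_ground (R : realType) (k : ground) :
    ground_field R k -> ground_field R k :=
  match k with RealGround => fun x => x | ComplexGround => @conjc R end.

Definition toC (R : realType) (k : ground) : ground_field R k -> R[i] :=
  match k with RealGround => real_complex R | ComplexGround => fun z => z end.

Definition adjmx (R : realType) (k : ground) (m n : nat)
    (A : 'M[ground_field R k]_(m, n)) : 'M[ground_field R k]_(n, m) :=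
  map_mx (@conj_ground R k) A^T.

Definition unitary (R : realType) (k : ground) (n : nat)
    (U : 'M[ground_field R k]_n) : Prop :=
  adjmx U *m U = 1%:M.

(* On R[i] the order makes [0 <= z] mean that z is real and nonnegative. *)
Definition psdmx (R : realType) (k : ground) (n : nat)
    (W : 'M[ground_field R k]_n) : Prop :=
  adjmx W = W /\
  forall x : 'cV[ground_field R k]_n, 0 <= (adjmx x *m W *m x) 0 0.

Definition real_diagmx (F : numFieldType) (n : nat) (D : 'M[F]_n) : Prop :=
  is_diag_mx D /\ forall i, D i i \is Num.real.

Definition nonneg_diagmx (F : numFieldType) (n : nat) (D : 'M[F]_n) : Prop :=
  is_diag_mx D /\ forall i, 0 <= D i i.

(* Throughout, a pair of matrices (A, B) of the same size stands for the
   pencil lambda A - B. *)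

Definition regular_pencil (F : fieldType) (m n : nat)
    (A B : 'M[F]_(m, n)) : Prop :=
  exists e : m = n,
    \det (castmx (e, erefl n) ('X *: map_mx polyC A - map_mx polyC B)) != 0.

Definition singular_pencil (F : fieldType) (m n : nat)
    (A B : 'M[F]_(m, n)) : Prop :=
  ~ regular_pencil A B.

(* Blocks of the Kronecker canonical form.  [JordanBlock a p] and [InfBlock p]
   have size p.+1, so that empty Jordan blocks are excluded. *)
Variant kblock (C : Type) :=
  | RightBlock of nat
  | LeftBlock of nat
  | JordanBlock of C & nat
  | InfBlock of nat.
Arguments RightBlock {C}.
Arguments LeftBlock {C}.
Arguments InfBlock {C}.

Definition kblock_rows (C : Type) (b : kblock C) : nat :=
  match b with
  | RightBlock e => e
  | LeftBlock e => e.+1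
  | JordanBlock _ p => p.+1
  | InfBlock p => p.+1
  end.

Definition kblock_cols (C : Type) (b : kblock C) : nat :=
  match b with
  | RightBlock e => e.+1
  | LeftBlock e => e
  | JordanBlock _ p => p.+1
  | InfBlock p => p.+1
  end.

Section Blocks.
Variable C : fieldType.

(* [I 0] and [0 I], of size e x e.+1. *)
Definition idl_mx (e : nat) : 'M[C]_(e, e.+1) :=
  \matrix_(i, j) (i == j :> nat)%:R.
Definition idr_mx (e : nat) : 'M[C]_(e, e.+1) :=
  \matrix_(i, j) (i.+1 == j :> nat)%:R.

Definition jordan_mx (a : C) (p : nat) : 'M[C]_p.+1 :=
  \matrix_(i, j) (a *+ (i == j) + (i.+1 == j :> nat)%:R).

Definition kblock_fst (b : kblock C) : 'M[C]_(kblock_rows b, kblock_cols b) :=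
  match b with
  | RightBlock e => idl_mx e
  | LeftBlock e => (idl_mx e)^T
  | JordanBlock _ p => 1%:M
  | InfBlock p => jordan_mx 0 p
  end.

Definition kblock_snd (b : kblock C) : 'M[C]_(kblock_rows b, kblock_cols b) :=
  match b with
  | RightBlock e => idr_mx e
  | LeftBlock e => (idr_mx e)^T
  | JordanBlock a p => jordan_mx a p
  | InfBlock p => 1%:M
  end.

Fixpoint kcf_rows (K : seq (kblock C)) : nat :=
  if K is b :: K' then kblock_rows b + kcf_rows K' else 0.

Fixpoint kcf_cols (K : seq (kblock C)) : nat :=
  if K is b :: K' then kblock_cols b + kcf_cols K' else 0.

Fixpoint kcf_fst (K : seq (kblock C)) : 'M[C]_(kcf_rows K, kcf_cols K) :=
  match K with
  | [::] => 0
  | b :: K' => block_mx (kblock_fst b) 0 0 (kcf_fst K')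
  end.

Fixpoint kcf_snd (K : seq (kblock C)) : 'M[C]_(kcf_rows K, kcf_cols K) :=
  match K with
  | [::] => 0
  | b :: K' => block_mx (kblock_snd b) 0 0 (kcf_snd K')
  end.

Definition is_kcf (K : seq (kblock C)) (m n : nat) (A B : 'M[C]_(m, n)) :
    Prop :=
  exists (em : kcf_rows K = m) (en : kcf_cols K = n)
         (S : 'M[C]_m) (T : 'M[C]_n),
    [/\ S \in unitmx, T \in unitmx,
        S *m A *m T = castmx (em, en) (kcf_fst K) &
        S *m B *m T = castmx (em, en) (kcf_snd K)].

End Blocks.

Definition is_left_block (C : Type) (b : kblock C) : bool :=
  if b is LeftBlock _ then true else false.

Definition is_regular_block (C : Type) (b : kblock C) : bool :=
  match b with JordanBlock _ _ | InfBlock _ => true | _ => false end.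

Definition regular_blocks (C : Type) (K : seq (kblock C)) : seq (kblock C) :=
  [seq b <- K | is_regular_block b].

Definition left_indices (C : Type) (K : seq (kblock C)) : seq nat :=
  pmap (fun b => if b is LeftBlock e then Some e else None) K.

Definition right_indices (C : Type) (K : seq (kblock C)) : seq nat :=
  pmap (fun b => if b is RightBlock e then Some e else None) K.

(* The Kronecker canonical form of a real pencil is that of the same pencil
   regarded over the complex numbers, where eigenvalues always exist.  The
   block list is determined by the pencil up to permutation. *)
Definition has_kcf (R : realType) (k : ground) (m n : nat)
    (A B : 'M[ground_field R k]_(m, n)) (K : seq (kblock R[i])) : Prop :=
  is_kcf K (map_mx (@toC R k) A) (map_mx (@toC R k) B).

Definition staircase_mx (F : nzRingType) (n1 m2 n2 r : nat)
    (A11 : 'M[F]_n1) (A12 : 'M[F]_(n1, n2)) (A22 : 'M[F]_(m2, n2)) :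
    'M[F]_(n1 + m2, n1 + n2 + r) :=
  row_mx (block_mx A11 A12 0 A22) 0.
Arguments staircase_mx {F n1 m2 n2} r A11 A12 A22.

Definition ker_sub (F : nzRingType) (p q n : nat)
    (A : 'M[F]_(p, n)) (B : 'M[F]_(q, n)) : Prop :=
  forall x : 'cV[F]_n, A *m x = 0 -> B *m x = 0.

(* [em] and [en] force m2 = m - n1 and r = n - n1 - n2. *)
Record is_condensed_form (R : realType) (k : ground) (m n : nat)
    (E Q : 'M[ground_field R k]_(m, n)) (n1 m2 n2 r : nat)
    (em : (n1 + m2)%N = m) (en : (n1 + n2 + r)%N = n)
    (U : 'M[ground_field R k]_m) (X : 'M[ground_field R k]_n)
    (E11 Q11 : 'M[ground_field R k]_n1)
    (E12 Q12 : 'M[ground_field R k]_(n1, n2))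
    (E22 Q22 : 'M[ground_field R k]_(m2, n2)) : Prop := IsCondensedForm {
  cond_unitary : unitary U;
  cond_nonsingular : X \in unitmx;
  cond_E : U *m E *m X = castmx (em, en) (staircase_mx r E11 E12 E22);
  cond_Q : U *m Q *m X = castmx (em, en) (staircase_mx r Q11 Q12 Q22);
  cond_diag : [/\ real_diagmx E11, real_diagmx Q11 &
                  E11 *m E11 + Q11 *m Q11 = 1%:M];
  cond_size : ((n2 < m2)%N /\ singular_pencil E22 Q22) \/
              (m2 = 0%N /\ n2 = 0%N);
  cond_left : exists K22, has_kcf E22 Q22 K22 /\ all (@is_left_block _) K22;
  cond_ker : ker_sub E22 E12 /\ ker_sub Q22 Q12;
  cond_kcf : exists K K22,
    [/\ has_kcf E Q K /\
          has_kcf (staircase_mx r E11 0 E22) (staircase_mx r Q11 0 Q22) K,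
        has_kcf E11 Q11 (regular_blocks K),
        has_kcf E22 Q22 K22 /\ perm_eq (left_indices K) (left_indices K22) &
        right_indices K = nseq (n - n1 - n2) 0%N]
}.

(* [P] collects the additional requirements imposed on E11 and Q11 by the
   choice of U and X. *)
Definition has_condensed_form (R : realType) (k : ground) (m n : nat)
    (E Q : 'M[ground_field R k]_(m, n))
    (P : forall n1 : nat,
       'M[ground_field R k]_n1 -> 'M[ground_field R k]_n1 -> Prop) : Prop :=
  exists (n1 m2 n2 r : nat) (em : (n1 + m2)%N = m) (en : (n1 + n2 + r)%N = n)
    (U : 'M[ground_field R k]_m) (X : 'M[ground_field R k]_n)
    (E11 Q11 : 'M[ground_field R k]_n1)
    (E12 Q12 : 'M[ground_field R k]_(n1, n2))
    (E22 Q22 : 'M[ground_field R k]_(m2, n2)),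
    is_condensed_form E Q em en U X E11 Q11 E12 Q12 E22 Q22 /\ P n1 E11 Q11.

(* Main.v *)
Require Import Defs.
From HB Require Import structures.
From mathcomp Require Import all_boot all_order all_algebra.
From mathcomp Require Import complex.
From mathcomp Require Import reals boolp.
From mathcomp Require Import ring lra zify.

Set Implicit Arguments.
Unset Strict Implicit.
Unset Printing Implicit Defensive.

Import Order.TTheory GRing.Theory Num.Theory.
Local Open Scope ring_scope.

(** Write A^H for the adjoint.  The form can be chosen with E12 = Q12 = 0, that
    is, the regular part splits off orthogonally.  The reason is the symmetry
    E^H Q = Q^H E.  If x is an eigenvector, q E x = e Q x with real e, q and
    e^2 + q^2 = 1, put w = e E x + q Q x.  Then E x = e w and Q x = q w, and
    multiplying the symmetry relation by x^H gives q w^H E = e w^H Q, so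
    w^H E = e f and w^H Q = q f for one row f, with f x = w^H w.  If w = 0 then x
    is a common kernel vector and splits off as a zero column, a right minimal
    index 0.  Otherwise, after scaling w to length one, completing w to a unitary
    matrix ([unit_completion]) and x by a basis of the kernel of f
    ([split_complement]) makes E and Q block diagonal with first entries e and q,
    and the remaining blocks satisfy the same symmetry.

    When no such real pair (e, q) is left, there is no complex eigenpair either:
    from a y = b z with y = E x, z = Q x and y^H z real, the ratio of a and b is
    real ([proportional_real_ratio]), and a kernel vector of the real combination
    of E and Q then exists over the ground field ([no_real_eigenpair]).  This
    gives the block decomposition [hermitian_splitting].

    There remains a pencil whose combinations a A - b B are all injective over the
    complex numbers, and it must be a direct sum of left blocks
    ([no_eigenpair_left_blocks]).  Let A, B map V to W, and let V' be the space of
    all v with B v in the image of A.  Since A is injective, B restricted to V' is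
    A composed with some B' from V' to V; with the inclusion A' this yields a new
    pencil from V' to V, again without eigenpairs, and smaller: V' = V would give
    an endomorphism B' of V, which has an eigenvector.  Conversely, the subspace
    A V + B V of W is the cokernel of (B', - A') from V' to the direct sum of two
    copies of V, and this construction turns a left block of index i into one of
    index i + 1.  A complement of A V + B V in W contributes left blocks of
    index 0.  As every left block has one row more than columns, the block
    (E22, Q22) is strictly tall or empty.

    The sign of (e, q) is free, since w may be replaced by - w; and
    e q = x^H E^H Q x, for w of length one, is nonnegative when E^H Q is positive
    semidefinite. *)

(** * Equivalence of pencils and Kronecker blocks *)

Section Pencils.
Variable F : fieldType.
Implicit Types (m n p q : nat) (K : seq (kblock F)).

(** Invertibility for matrices whose two dimensions agree only provably: with
    it the sizes of a pencil and of its canonical form need not be identified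
    until the very end, and almost no casts occur. *)
Definition iso_mx m n (S : 'M[F]_(m, n)) : Prop :=
  exists S' : 'M_(n, m), S *m S' = 1%:M /\ S' *m S = 1%:M.

Lemma iso_mx_dim m n (S : 'M_(m, n)) : iso_mx S -> m = n.
Proof.
by case=> S' [h1 h2]; apply/eqP; rewrite eqn_leq (mulmx1_min h1) (mulmx1_min h2).
Qed.

Lemma iso_mx1 n : iso_mx (1%:M : 'M_n).
Proof. by exists 1%:M; rewrite mulmx1. Qed.

Lemma iso_mx_mul m n p (S : 'M_(m, n)) (T : 'M_(n, p)) :
  iso_mx S -> iso_mx T -> iso_mx (S *m T).
Proof.
move=> [S' [h1 h2]] [T' [h3 h4]]; exists (T' *m S'); split.
  by rewrite mulmxA -(mulmxA S) h3 mulmx1.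
by rewrite mulmxA -(mulmxA T') h2 mulmx1.
Qed.

Lemma iso_mx_block m n p q (S : 'M_(m, n)) (T : 'M_(p, q)) :
  iso_mx S -> iso_mx T -> iso_mx (block_mx S 0 0 T).
Proof.
move=> [S' [h1 h2]] [T' [h3 h4]]; exists (block_mx S' 0 0 T').
by rewrite !mulmx_block !mul0mx !mulmx0 !addr0 !add0r h1 h2 h3 h4 -!scalar_mx_block.
Qed.

Lemma iso_mx_col0 p : iso_mx (col_mx 0 1%:M : 'M_(0 + p, p)).
Proof.
exists (row_mx 0 1%:M); split.
  rewrite mul_col_row [RHS]scalar_mx_block !mul1mx.
  by congr block_mx; apply/matrixP => i j; rewrite ?mul0mx ?mxE //; case: i; case: j.
by rewrite mul_row_col mulmx0 mul1mx add0r.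
Qed.

Lemma iso_mx_row0 p : iso_mx (row_mx 1%:M 0 : 'M_(p, p + 0)).
Proof.
exists (col_mx 1%:M 0); split; first by rewrite mul_row_col mulmx0 mul1mx addr0.
rewrite mul_col_row [RHS]scalar_mx_block !mul1mx.
by congr block_mx; apply/matrixP => i j; rewrite ?mul0mx ?mxE //; case: i; case: j.
Qed.

Definition pencil_equiv m n m' n' (A B : 'M[F]_(m, n)) (A' B' : 'M[F]_(m', n')) :
    Prop :=
  exists (S : 'M_(m, m')) (T : 'M_(n, n')),
    [/\ iso_mx S, iso_mx T, A *m T = S *m A' & B *m T = S *m B'].

Lemma pencil_equiv_refl m n (A B : 'M_(m, n)) : pencil_equiv A B A B.
Proof. by exists 1%:M, 1%:M; split; rewrite ?mulmx1 ?mul1mx //; apply: iso_mx1. Qed.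

Lemma pencil_equiv_trans m1 n1 m2 n2 m3 n3 (A1 B1 : 'M_(m1, n1))
    (A2 B2 : 'M_(m2, n2)) (A3 B3 : 'M_(m3, n3)) :
  pencil_equiv A1 B1 A2 B2 -> pencil_equiv A2 B2 A3 B3 ->
  pencil_equiv A1 B1 A3 B3.
Proof.
move=> [S [T [hS hT hA hB]]] [S' [T' [hS' hT' hA' hB']]].
exists (S *m S'), (T *m T'); split; try exact: iso_mx_mul.
  by rewrite mulmxA hA -!mulmxA hA'.
by rewrite mulmxA hB -!mulmxA hB'.
Qed.

Lemma pencil_equiv_block m n m' n' p q p' q' (A B : 'M_(m, n))
    (A' B' : 'M_(m', n')) (C D : 'M_(p, q)) (C' D' : 'M_(p', q')) :
  pencil_equiv A B A' B' -> pencil_equiv C D C' D' ->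
  pencil_equiv (block_mx A 0 0 C) (block_mx B 0 0 D)
               (block_mx A' 0 0 C') (block_mx B' 0 0 D').
Proof.
move=> [S [T [hS hT hA hB]]] [S' [T' [hS' hT' hA' hB']]].
exists (block_mx S 0 0 S'), (block_mx T 0 0 T').
split; try exact: iso_mx_block.
  by rewrite !mulmx_block !mul0mx !mulmx0 !addr0 !add0r hA hA'.
by rewrite !mulmx_block !mul0mx !mulmx0 !addr0 !add0r hB hB'.
Qed.

Lemma pencil_equiv_cast m n m' n' (e : (m = m') * (n = n')) (A B : 'M_(m, n)) :
  pencil_equiv A B (castmx e A) (castmx e B).
Proof.
case: e => em en; subst m' n'; rewrite !castmx_id.
exact: pencil_equiv_refl.
Qed.

Lemma pencil_equiv_add0l m n (A B : 'M_(m, n)) :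
  pencil_equiv (block_mx (0 : 'M_(0, 0)) 0 0 A) (block_mx (0 : 'M_(0, 0)) 0 0 B) A B.
Proof.
exists (col_mx 0 1%:M), (col_mx 0 1%:M); split; try exact: iso_mx_col0.
  by rewrite mul_block_col mul_col_mx !mul0mx ?mulmx0 mulmx1 mul1mx ?add0r.
by rewrite mul_block_col mul_col_mx !mul0mx ?mulmx0 mulmx1 mul1mx ?add0r.
Qed.

(** The cast-free counterpart of [is_kcf]. *)
Definition kronecker K m n (A B : 'M_(m, n)) : Prop :=
  pencil_equiv A B (kcf_fst K) (kcf_snd K).

Lemma kronecker_is_kcf K m n (A B : 'M_(m, n)) : kronecker K A B -> is_kcf K A B.
Proof.
case=> S [T [hS hT hA hB]].
have em := iso_mx_dim hS; have en := iso_mx_dim hT; subst m n.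
case: hS => S' [hS1 hS2]; case: hT => T' [hT1 hT2].
exists erefl, erefl, S', T; rewrite !castmx_id; split.
- by case: (mulmx1_unit hS1).
- by case: (mulmx1_unit hT1).
- by rewrite -mulmxA hA mulmxA hS2 mul1mx.
- by rewrite -mulmxA hB mulmxA hS2 mul1mx.
Qed.

(** The canonical form of a concatenated block list is a right-nested block
    sum, so this is associativity of direct sums of pencils. *)
Lemma kcf_cat K1 K2 :
  pencil_equiv (block_mx (kcf_fst K1) 0 0 (kcf_fst K2))
               (block_mx (kcf_snd K1) 0 0 (kcf_snd K2))
               (kcf_fst (K1 ++ K2)) (kcf_snd (K1 ++ K2)).
Proof.
elim: K1 => [|b K1 IH] /=; first exact: pencil_equiv_add0l.
pose A1 := kcf_fst K1; pose B1 := kcf_snd K1.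
pose A2 := kcf_fst K2; pose B2 := kcf_snd K2.
have hA := @block_mxA F _ _ _ _ _ _ (kblock_fst b) 0 0 0 A1 0 0 0 A2.
have hB := @block_mxA F _ _ _ _ _ _ (kblock_snd b) 0 0 0 B1 0 0 0 B2.
move: hA hB; rewrite /= !row_mx0 !col_mx0.
set e := (X in castmx X _) => hA hB.
have h := pencil_equiv_block
  (pencil_equiv_refl (kblock_fst b) (kblock_snd b)) IH.
apply: pencil_equiv_trans h; rewrite hA hB.
exact: pencil_equiv_cast.
Qed.

Lemma kronecker_cat K1 K2 m1 n1 m2 n2 (A1 B1 : 'M_(m1, n1)) (A2 B2 : 'M_(m2, n2)) :
  kronecker K1 A1 B1 -> kronecker K2 A2 B2 ->
  kronecker (K1 ++ K2) (block_mx A1 0 0 A2) (block_mx B1 0 0 B2).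
Proof.
by move=> h1 h2; apply: pencil_equiv_trans (kcf_cat K1 K2); apply: pencil_equiv_block.
Qed.

Lemma kronecker_block (b : kblock F) :
  kronecker [:: b] (kblock_fst b) (kblock_snd b).
Proof.
rewrite /kronecker /=.
exists (row_mx 1%:M 0), (row_mx 1%:M 0); split; try exact: iso_mx_row0.
  by rewrite mul_mx_row mul_row_block !mul0mx !mulmx0 mul1mx mulmx1 !addr0.
by rewrite mul_mx_row mul_row_block !mul0mx !mulmx0 mul1mx mulmx1 !addr0.
Qed.

Lemma pencil_equiv_no_cols m m' (A B : 'M_(m, 0)) (A' B' : 'M_(m', 0)) :
  m = m' -> pencil_equiv A B A' B'.
Proof.
move=> em; subst m'; exists 1%:M, 1%:M.
by split; try exact: iso_mx1; apply/matrixP => i [].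
Qed.

Lemma kronecker_empty_left d (Z W : 'M_(d, 0)) :
  kronecker (nseq d (LeftBlock 0)) Z W.
Proof.
have er : kcf_rows (nseq d (LeftBlock 0) : seq (kblock F)) = d.
  by elim: d {Z W} => //= d ->.
have ec : kcf_cols (nseq d (LeftBlock 0) : seq (kblock F)) = 0%N.
  by elim: d {Z W er} => //= d ->.
rewrite /kronecker; move: (kcf_fst _) (kcf_snd _).
move: (kcf_rows _) (kcf_cols _) er ec => p q -> -> A B.
exact: pencil_equiv_no_cols.
Qed.

Lemma kronecker_empty_right d (Z W : 'M_(0, d)) :
  kronecker (nseq d (RightBlock 0)) Z W.
Proof.
have er : kcf_rows (nseq d (RightBlock 0) : seq (kblock F)) = 0%N.
  by elim: d {Z W} => //= d ->.
have ec : kcf_cols (nseq d (RightBlock 0) : seq (kblock F)) = d.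
  by elim: d {Z W er} => //= d ->.
rewrite /kronecker; move: (kcf_fst _) (kcf_snd _).
move: (kcf_rows _) (kcf_cols _) er ec => p q -> -> A B.
by exists 1%:M, 1%:M; split; try exact: iso_mx1; apply/matrixP => -[].
Qed.

Lemma kronecker_col0 K m n d (A B : 'M_(m, n)) : kronecker K A B ->
  kronecker (K ++ nseq d (LeftBlock 0)) (col_mx A (0 : 'M_(d, n)))
    (col_mx B (0 : 'M_(d, n))).
Proof.
move=> h; apply: pencil_equiv_trans (kronecker_cat h (@kronecker_empty_left d 0 0)).
exists 1%:M, (row_mx 1%:M 0); split; first exact: iso_mx1.
- exact: iso_mx_row0.
- by rewrite mul1mx mul_col_row !mulmx1 !mulmx0 ?mul0mx.
- by rewrite mul1mx mul_col_row !mulmx1 !mulmx0 ?mul0mx.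
Qed.

Lemma kronecker_row0 K m n d (A B : 'M_(m, n)) : kronecker K A B ->
  kronecker (K ++ nseq d (RightBlock 0)) (row_mx A (0 : 'M_(m, d)))
    (row_mx B (0 : 'M_(m, d))).
Proof.
move=> h; apply: pencil_equiv_trans (kronecker_cat h (@kronecker_empty_right d 0 0)).
exists (row_mx 1%:M 0), 1%:M; split.
- exact: iso_mx_row0.
- exact: iso_mx1.
- by rewrite mulmx1 mul_row_block !mul1mx ?mul0mx !addr0.
- by rewrite mulmx1 mul_row_block !mul1mx ?mul0mx !addr0.
Qed.

End Pencils.

(** * Pencils without eigenvalues *)

Section LeftPencils.
Variable F : fieldType.
Implicit Types (m n p q : nat).

(** The matrices [M], [N], [Y] witness that [row_mx A' B'] is a cokernel of
    [col_mx B (- A)]: the composite is zero, the columns of [A'] and [B'] jointly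
    span, and any pair [(P, P')] with
    [P' *m A = P *m B] factors as [P = W *m A'], [P' = W *m B'], where
    [W = P *m M + P' *m N].  Spelling the witnesses out makes the property
    visibly stable under direct sums. *)
Definition shift_pencil p q u (A B : 'M[F]_(p, u)) (A' B' : 'M[F]_(q, p)) : Prop :=
  exists (M N : 'M_(p, q)) (Y : 'M_(u, p)),
    [/\ A' *m B = B' *m A, A' *m M + B' *m N = 1%:M,
        M *m A' = 1%:M /\ N *m A' = 0, M *m B' = B *m Y &
        N *m B' = 1%:M - A *m Y].

Lemma shift_pencil_block p q u p' q' u' (A B : 'M_(p, u)) (A' B' : 'M_(q, p))
    (C D : 'M_(p', u')) (C' D' : 'M_(q', p')) :
  shift_pencil A B A' B' -> shift_pencil C D C' D' ->
  shift_pencil (block_mx A 0 0 C) (block_mx B 0 0 D)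
               (block_mx A' 0 0 C') (block_mx B' 0 0 D').
Proof.
move=> [M [N [Y [h1 h2 [h3 h4] h5 h6]]]] [M' [N' [Y' [h1' h2' [h3' h4'] h5' h6']]]].
exists (block_mx M 0 0 M'), (block_mx N 0 0 N'), (block_mx Y 0 0 Y').
rewrite !mulmx_block !mul0mx !mulmx0 !addr0 !add0r add_block_mx !addr0.
rewrite h1 h1' h2 h2' h3 h3' h4 h4' h5 h5' h6 h6' -!scalar_mx_block block_mx0.
split=> //.
by rewrite opp_block_mx scalar_mx_block add_block_mx !oppr0 !addr0.
Qed.

Lemma sum_pick n (i : nat) (P : nat -> bool) (f : 'I_n -> F) :
  (forall k : 'I_n, f k = ((i == k :> nat) && P k)%:R) ->
  \sum_k f k = ((i < n)%N && P i)%:R.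
Proof.
move=> hf; rewrite (eq_bigr _ (fun k _ => hf k)); case: (ltnP i n) => hi /=.
  rewrite (bigD1 (Ordinal hi)) //= eqxx big1 ?addr0 // => k hk.
  by rewrite -val_eqE /= eq_sym in hk; rewrite (negPf hk).
by rewrite big1 // => k _; have := ltn_ord k; case: eqP => //= <-; rewrite ltnNge hi.
Qed.

Lemma shift_pencil_left e :
  shift_pencil (idl_mx F e)^T (idr_mx F e)^T (idl_mx F e.+1)^T (idr_mx F e.+1)^T.
Proof.
(* [N] keeps only the last coordinate, the one that the image of [A'] misses. *)
exists (idl_mx F e.+1), (\matrix_(i, j) ((e == i :> nat) && (e.+1 == j :> nat))%:R),
  (idl_mx F e).
split; [| |split| |]; apply/matrixP => i j; rewrite !mxE /=;
  have hi := ltn_ord i; have hj := ltn_ord j; rewrite /= in hi hj.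
- rewrite (@sum_pick _ j.+1 (fun k => k == i)) => [|k].
    rewrite (@sum_pick _ j (fun k => k.+1 == i)) => [|k].
      by congr (nat_of_bool _)%:R; lia.
    by rewrite !mxE -natrM mulnb; congr (nat_of_bool _)%:R; lia.
  by rewrite !mxE -natrM mulnb; congr (nat_of_bool _)%:R; lia.
- rewrite (@sum_pick _ i (fun k => k == j)) => [|k].
    rewrite (@sum_pick _ e (fun k => (k.+1 == i) && (e.+1 == j))) => [|k].
      rewrite -natrD -val_eqE /= ltnSn /=; congr (_%:R).
      by case: ltnP => ?; do 3?case: eqP => //= ?; lia.
    by rewrite !mxE -natrM mulnb; congr (nat_of_bool _)%:R; lia.
  by rewrite !mxE -natrM mulnb; congr (nat_of_bool _)%:R; lia.
- rewrite (@sum_pick _ i (fun k => k == j)) => [|k].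
    by rewrite -val_eqE /=; congr (nat_of_bool _)%:R; lia.
  by rewrite !mxE -natrM mulnb; congr (nat_of_bool _)%:R; lia.
- rewrite big1 // => k _.
  by rewrite !mxE -natrM mulnb (_ : _ && _ = false) //; lia.
- rewrite (@sum_pick _ i (fun k => j.+1 == k)) => [|k].
    rewrite (@sum_pick _ j (fun k => k.+1 == i)) => [|k].
      by congr (nat_of_bool _)%:R; lia.
    by rewrite !mxE -natrM mulnb; congr (nat_of_bool _)%:R; lia.
  by rewrite !mxE -natrM mulnb; congr (nat_of_bool _)%:R; lia.
- rewrite (@sum_pick _ j.+1 (fun k => (e == i) && (e.+1 == k))) => [|k].
    rewrite (@sum_pick _ j (fun k => k == i)) => [|k].
      rewrite -val_eqE /=; apply/eqP; rewrite -subr_eq0 opprB addrA subr_eq0 -natrD.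
      apply/eqP; congr (_%:R).
      by case: ltnP => ?; do 3?case: eqP => //= ?; lia.
    by rewrite !mxE -natrM mulnb; congr (nat_of_bool _)%:R; lia.
  by rewrite !mxE -natrM mulnb; congr (nat_of_bool _)%:R; lia.
Qed.

(** The cokernel construction raises each left minimal index by one. *)
Lemma kronecker_shift (s : seq nat) :
  exists q (A' B' : 'M[F]_(q, kcf_rows [seq LeftBlock e : kblock F | e <- s])),
    kronecker [seq LeftBlock e.+1 | e <- s] A' B' /\
    shift_pencil (kcf_fst [seq LeftBlock e | e <- s])
                 (kcf_snd [seq LeftBlock e | e <- s]) A' B'.
Proof.
elim: s => [|e s [q [A' [B' [hk hs]]]]] /=.
  exists 0%N, 0, 0; split; first exact: pencil_equiv_refl.
  by exists 0, 0, 0; split; [| |split| |]; apply/matrixP => -[].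
exists (e.+2 + q)%N, (block_mx (kblock_fst (LeftBlock e.+1)) 0 0 A'),
  (block_mx (kblock_snd (LeftBlock e.+1)) 0 0 B'); split.
  exact: (kronecker_cat (kronecker_block (LeftBlock e.+1)) hk).
exact: (shift_pencil_block (shift_pencil_left e) hs).
Qed.

Definition col_inj m n (A : 'M[F]_(m, n)) : Prop :=
  forall x : 'cV_n, A *m x = 0 -> x = 0.

Lemma col_injP m n (A : 'M_(m, n)) : col_inj A <-> exists L, L *m A = 1%:M.
Proof.
split=> [hA|[L hL] x hx]; last by rewrite -[x]mul1mx -hL -mulmxA hx mulmx0.
apply/row_fullP; rewrite /row_full -mxrank_tr -[_ == n]/(row_free A^T) -kermx_eq0.
apply/rowV0P => v /sub_kermxP hv.
by apply: trmx_inj; rewrite trmx0; apply: hA; rewrite -[A]trmxK -trmx_mul hv trmx0.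
Qed.

(** [1 - x f] is idempotent; a full rank factorization [Y g] of it yields a
    complement of the image of [x] inside the kernel of [f]. *)
Lemma split_complement n p (x : 'M[F]_(n, p)) (f : 'M_(p, n)) : f *m x = 1%:M ->
  exists d (Y : 'M_(n, d)) (g : 'M_(d, n)),
    [/\ x *m f + Y *m g = 1%:M, g *m Y = 1%:M, f *m Y = 0, g *m x = 0 &
        (p + d = n)%N].
Proof.
move=> fx; pose P : 'M_n := 1%:M - x *m f.
have fP : f *m P = 0 by rewrite mulmxBr mulmx1 mulmxA fx mul1mx subrr.
have Px : P *m x = 0 by rewrite mulmxBl mul1mx -mulmxA fx mulmx1 subrr.
have PP : P *m P = P by rewrite {2}/P mulmxBr mulmx1 mulmxA Px mul0mx subr0.
have := mulmx_base P; have /row_fullP := col_base_full P.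
have /row_freeP := row_base_free P.
move: (\rank P) (col_base P) (row_base P) => d Y g [N gN] [L LY] Yg.
have h1 : x *m f + Y *m g = 1%:M by rewrite Yg addrC subrK.
have h2 : f *m Y = 0 by rewrite -[f *m Y]mulmx1 -gN mulmxA -(mulmxA f) Yg fP mul0mx.
have h3 : g *m x = 0 by rewrite -[g *m x]mul1mx -LY -mulmxA (mulmxA Y) Yg Px mulmx0.
have h4 : g *m Y = 1%:M.
  transitivity (L *m Y *m (g *m Y) *m (g *m N)).
    by rewrite LY gN mul1mx mulmx1.
  rewrite -!mulmxA (mulmxA Y g N) (mulmxA Y g) Yg (mulmxA P) PP -Yg -mulmxA gN.
  by rewrite mulmx1.
exists d, Y, g; split=> //.
have iso : iso_mx (row_mx x Y).
  exists (col_mx f g); rewrite mul_row_col mul_col_row h1 h2 h3 h4 fx.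
  by rewrite -scalar_mx_block.
by rewrite (iso_mx_dim iso).
Qed.

(** The pair [(a, b)] ranges over homogeneous coordinates, so that infinite
    eigenvalues and common kernel vectors are excluded as well. *)
Definition no_eigenpair m n (A B : 'M[F]_(m, n)) : Prop :=
  forall (a b : F) (x : 'cV_n), (a != 0) || (b != 0) ->
    a *: (A *m x) = b *: (B *m x) -> x = 0.

(** The columns of [A'] span the preimage under [B] of the image of [A]; there
    [B] factors through [A], which gives [B'].  The pencil [(A', B')] is the
    image of [(A, B)] under a reflection functor. *)
Lemma deflation m n (A B : 'M[F]_(m, n)) : col_inj A ->
  exists k (A' B' : 'M_(n, k)),
    [/\ B *m A' = A *m B', col_inj A' &
        forall u v : 'cV_n, B *m v = A *m u -> exists c, v = A' *m c].
Proof.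
move=> injA; pose Z := (row_base (kermx (row_mx B (- A))^T))^T.
have hZ : row_mx B (- A) *m Z = 0.
  apply: trmx_inj; rewrite trmx_mul trmxK trmx0; apply/sub_kermxP.
  by rewrite eq_row_base.
have Zinj : col_inj Z.
  move=> c hc; apply: trmx_inj; apply: (row_free_inj (row_base_free _)).
  by rewrite -[row_base _]trmxK -trmx_mul hc !trmx0 mul0mx.
have Zuniv (y : 'cV_(n + n)) : row_mx B (- A) *m y = 0 -> exists c, y = Z *m c.
  move=> hy; have : (y^T <= row_base (kermx (row_mx B (- A))^T))%MS.
    by rewrite eq_row_base; apply/sub_kermxP; rewrite -trmx_mul hy trmx0.
  case/submxP=> c hc; exists c^T.
  by apply: trmx_inj; rewrite trmx_mul !trmxK.
move: hZ Zinj Zuniv; rewrite -[Z]vsubmxK mul_row_col mulNmx.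
move: (usubmx Z) (dsubmx Z) => A' B' /subr0_eq BA inj univ.
exists (\rank (kermx (row_mx B (- A))^T)), A', B'; split=> //.
- move=> c hc; apply: inj; rewrite mul_col_mx hc; apply/eqP.
  rewrite col_mx_eq0 eqxx /=; apply/eqP/injA.
  by rewrite mulmxA -BA -mulmxA hc mulmx0.
- move=> u v huv; have [|c] := univ (col_mx v u).
    by rewrite mul_row_col mulNmx huv subrr.
  by rewrite mul_col_mx => /eq_col_mx[-> _]; exists c.
Qed.

End LeftPencils.

(** Induction on the number of columns: [deflation] replaces [(A, B)] by a
    pencil with fewer columns that still has no eigenpair.  By induction that
    pencil consists of left blocks, [kronecker_shift] reconstructs the span of
    the images of [A] and [B] as a sum of left blocks of index one higher, and
    each further dimension of the target contributes a left block of index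
    zero. *)
Lemma no_eigenpair_left_blocks (C : numClosedFieldType) m n (A B : 'M[C]_(m, n)) :
  no_eigenpair A B -> exists s, kronecker [seq LeftBlock e | e <- s] A B.
Proof.
elim: {n}_.+1 {-2}n (ltnSn n) m A B => // N IH n ltnN m A B noeig.
have injA : col_inj A.
  move=> x hx; apply: (noeig 1 0); first by rewrite oner_eq0.
  by rewrite hx scaler0 scale0r.
have [n0|n_gt0] := posnP n.
  by subst n; exists (nseq m 0%N); rewrite map_nseq; apply: kronecker_empty_left.
have [k [A' [B' [BA injA' univ]]]] := deflation B injA.
(* If [A'] were invertible, [B] would be [A *m (B' *m L)], and an eigenvalue of
   [B' *m L] would be one of the pencil. *)
have lekn : (k < n)%N.
  have [L hL] := (col_injP A').1 injA'.
  rewrite ltn_neqAle (mulmx1_min hL) andbT; apply/eqP => ekn; subst k.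
  have [a /eigenvalueP[v hv v0]] := eigenvalue_closed (B' *m L)^T n_gt0.
  case/eqP: v0; apply: trmx_inj; rewrite trmx0; apply: (noeig a 1).
    by rewrite oner_eq0 orbT.
  have : B' *m L *m v^T = a *: v^T.
    by rewrite -[B' *m L]trmxK -trmx_mul hv linearZ.
  rewrite scale1r -[B]mulmx1 -(mulmx1C hL) !mulmxA BA -!mulmxA => ->.
  by rewrite scalemxAr.
have noeig' : no_eigenpair A' B'.
  move=> a b x ab hx; apply: injA'; apply: (noeig a b) => //.
  by rewrite !mulmxA BA -!mulmxA [LHS]scalemxAr [RHS]scalemxAr hx.
have [|s [S [T [isoS isoT hA hB]]]] := IH k _ n A' B' noeig'; first by lia.
have [q [F' [G' [hK [M [P [Y [FG FMGP [MF PF] MG PG]]]]]]]] := kronecker_shift C s.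
pose W := A *m S *m M + B *m S *m P.
have [T' [TT' T'T]] := isoT; have [S' [SS' S'S]] := isoS.
set F := kcf_fst _ in hA FG MG PG; set G := kcf_snd _ in hB FG MG PG.
have ST : B *m S *m F = A *m S *m G.
  by rewrite -!mulmxA -hA -hB !mulmxA BA.
have WF : W *m F' = A *m S.
  by rewrite mulmxDl -!mulmxA MF PF !mulmx0 addr0 mulmx1.
have WG : W *m G' = B *m S.
  rewrite mulmxDl -mulmxA MG -(mulmxA _ P) PG mulmxBr mulmx1 !mulmxA ST.
  by rewrite addrC subrK.
(* If [A S a + B S b = 0] then [S b = A' c] and [S a = - B' c] for some [c]; in
   the coordinates [a], [b] this makes [F' a + G' b] a value of
   [G' F - F' G = 0]. *)
have injW : col_inj W.
  move=> z hz.
  have dec : z = F' *m (M *m z) + G' *m (P *m z) by rewrite !mulmxA -mulmxDl FMGP mul1mx.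
  move: dec hz; move: (M *m z) (P *m z) => a b ->.
  rewrite mulmxDr !mulmxA WF WG -!mulmxA => /eqP; rewrite addrC addr_eq0 -mulmxN -mulmxN.
  move=> /eqP hab; have [c hc] := univ _ _ hab.
  have Scan (x y : 'cV_(kcf_rows [seq LeftBlock e : kblock C | e <- s])) :
      S *m x = S *m y -> x = y.
    by move=> h; rewrite -[x]mul1mx -[y]mul1mx -S'S -!mulmxA h.
  have hb : b = F *m (T' *m c).
    by apply: Scan; rewrite hc -{1}[c]mul1mx -TT' -mulmxA (mulmxA A') hA -mulmxA.
  have ha : - a = G *m (T' *m c).
    apply: Scan; apply/eqP; rewrite -subr_eq0 -mulmxBr; apply/eqP/injA.
    rewrite !mulmxBr -hab hb; apply/eqP; rewrite subr_eq0; apply/eqP.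
    by rewrite !mulmxA -ST.
  by rewrite -[a]opprK ha hb mulmxN !mulmxA FG addNr.
have [L LW] := (col_injP W).1 injW.
have [d [Z [g [h1 h2 h3 h4 _]]]] := split_complement LW.
exists ([seq e.+1 | e <- s] ++ nseq d 0%N).
rewrite map_cat map_nseq -map_comp.
apply: pencil_equiv_trans (kronecker_col0 d hK).
exists (row_mx W Z), S; split=> //.
- exists (col_mx L g); rewrite mul_row_col mul_col_row h1 h2 h3 h4 LW.
  by rewrite -scalar_mx_block.
- by rewrite mul_row_col mulmx0 addr0 WF.
- by rewrite mul_row_col mulmx0 addr0 WG.
Qed.

(** * Adjoints and unitary completion over the two ground fields *)

(** One entry of the unitarity equation of [householder], with [b], [c] the scalar
    [v^H w] and its conjugate. *)
Fact householder_entry (K : fieldType) (a b c x : K) : b != 0 -> c != 0 ->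
  a - b^-1 * x - (c^-1 * x - c^-1 * (b^-1 * ((b + c) * x))) = a.
Proof. by move=> b0 c0; field; rewrite b0 c0. Qed.

Section Ground.
Variables (R : realType) (k : ground).
Local Notation F := (ground_field R k).
Local Notation C := R[i]%C.
Local Notation conj := (@conj_ground R k).
Implicit Types (m n p : nat).

Fact conj_ground_is_zmod_morphism : zmod_morphism conj.
Proof. by case: k => x y //=; rewrite rmorphB. Qed.

Fact conj_ground_is_monoid_morphism : monoid_morphism conj.
Proof. by case: k; split; first [exact: rmorph1 | exact: rmorphM | by []]. Qed.

HB.instance Definition _ := GRing.isZmodMorphism.Build F F conj
  conj_ground_is_zmod_morphism.
HB.instance Definition _ := GRing.isMonoidMorphism.Build F F conj
  conj_ground_is_monoid_morphism.

Fact toC_is_zmod_morphism : zmod_morphism (@toC R k).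
Proof. by case: k => x y //=; rewrite rmorphB. Qed.

Fact toC_is_monoid_morphism : monoid_morphism (@toC R k).
Proof. by case: k; split; first [exact: rmorph1 | exact: rmorphM | by []]. Qed.

HB.instance Definition _ := GRing.isZmodMorphism.Build F C (@toC R k)
  toC_is_zmod_morphism.
HB.instance Definition _ := GRing.isMonoidMorphism.Build F C (@toC R k)
  toC_is_monoid_morphism.

Definition ground_of_real : R -> F :=
  match k with RealGround => fun x => x | ComplexGround => real_complex R end.

Local Notation of_real := ground_of_real.

Fact of_real_is_zmod_morphism : zmod_morphism of_real.
Proof. by rewrite /ground_of_real; case: k => x y //=; rewrite rmorphB. Qed.

Fact of_real_is_monoid_morphism : monoid_morphism of_real.
Proof.
by rewrite /ground_of_real; case: k; split; first [exact: rmorph1 | exact: rmorphM | by []].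
Qed.

HB.instance Definition _ := GRing.isZmodMorphism.Build R F of_real
  of_real_is_zmod_morphism.
HB.instance Definition _ := GRing.isMonoidMorphism.Build R F of_real
  of_real_is_monoid_morphism.

Lemma conj_groundK : involutive conj.
Proof. by case: k => //= x; rewrite conjcK. Qed.

Lemma conj_of_real x : conj (of_real x) = of_real x.
Proof. by rewrite /ground_of_real; case: k; [|exact: conjc_real]. Qed.

Lemma conj_id_real (h : F) : conj h = h -> exists t, h = of_real t.
Proof.
rewrite /ground_of_real; case: k h => [h _|[a b] /= [hb]]; first by exists h.
exists a; congr (_ +i* _)%C.
by lra.
Qed.

Lemma toC_of_real x : toC (of_real x) = (x%:C)%C.
Proof. by rewrite /ground_of_real; case: k. Qed.

Lemma toC_conj x : toC (conj x) = conjc (toC x).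
Proof. by case: k x => x; [rewrite [RHS]conjc_real|]. Qed.

Lemma of_real_ge0 x : (0 <= of_real x) = (0 <= x).
Proof. by rewrite /ground_of_real; case: k; [|exact: ler0c]. Qed.

Lemma of_real_real x : of_real x \is Num.real.
Proof.
by rewrite realE -oppr_ge0 -rmorphN /= !of_real_ge0 oppr_ge0 le_total.
Qed.

Lemma conj_mul_self x : exists r, [/\ 0 <= r, conj x * x = of_real r & (r = 0 -> x = 0)].
Proof.
rewrite /ground_of_real; case: k x => /= x.
  by exists (x * x); rewrite -expr2 sqr_ge0; split=> // /eqP; rewrite sqrf_eq0 => /eqP.
exists (complex.Re x ^+ 2 + complex.Im x ^+ 2); split.
- by rewrite addr_ge0 ?sqr_ge0.
- by rewrite mulrC -sqr_normc -add_Re2_Im2.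
- move=> h; apply/eqP; rewrite -normr_eq0 -sqrf_eq0 -add_Re2_Im2 h //.
Qed.

Lemma adjmxM m n p (A : 'M[F]_(m, n)) (B : 'M_(n, p)) :
  adjmx (A *m B) = adjmx B *m adjmx A.
Proof. by rewrite /adjmx trmx_mul map_mxM. Qed.

Lemma adjmxK m n (A : 'M[F]_(m, n)) : adjmx (adjmx A) = A.
Proof. by apply/matrixP => i j; rewrite !mxE conj_groundK. Qed.

Lemma adjmxB m n (A B : 'M[F]_(m, n)) : adjmx (A - B) = adjmx A - adjmx B.
Proof. by rewrite /adjmx linearB map_mxB. Qed.

Lemma adjmxZ m n c (A : 'M[F]_(m, n)) : adjmx (c *: A) = conj c *: adjmx A.
Proof. by rewrite /adjmx linearZ /= map_mxZ. Qed.

Lemma adjmx1 n : adjmx (1%:M : 'M[F]_n) = 1%:M.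
Proof. by rewrite /adjmx trmx1 map_mx1. Qed.

Lemma adj_row_mx m n p (A : 'M[F]_(m, n)) (B : 'M_(m, p)) :
  adjmx (row_mx A B) = col_mx (adjmx A) (adjmx B).
Proof. by rewrite /adjmx tr_row_mx map_col_mx. Qed.

Lemma adj_col_mx m n p (A : 'M[F]_(m, n)) (B : 'M_(p, n)) :
  adjmx (col_mx A B) = row_mx (adjmx A) (adjmx B).
Proof. by rewrite /adjmx tr_col_mx map_row_mx. Qed.

Lemma adj_mul_self n (w : 'cV[F]_n) :
  exists r, [/\ 0 <= r, adjmx w *m w = (of_real r)%:M & (r = 0 -> w = 0)].
Proof.
elim: n w => [|n IH] w.
  exists 0; split=> //; first by apply/matrixP => i j; rewrite !mxE big_ord0 rmorph0 mul0rn.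
  by move=> _; apply/matrixP => -[].
rewrite -[w](@vsubmxK _ 1 n 1).
move: (usubmx _) (dsubmx _) => u v.
have [r [r0 hr rw]] := IH v.
have [s [s0 hs sw]] := conj_mul_self (u 0 0).
exists (s + r); split; first exact: addr_ge0.
  transitivity (adjmx u *m u + adjmx v *m v).
    by rewrite -mul_row_col -adj_col_mx.
  rewrite hr rmorphD /= raddfD /=.
  by congr (_ + _); apply/matrixP => i j; rewrite !ord1 !mxE big_ord1 !mxE hs mulr1n.
move=> /eqP; rewrite paddr_eq0 // => /andP[/eqP/sw u0 /eqP/rw ->].
by rewrite [u]mx11_scalar u0 raddf0 col_mx0.
Qed.

(** The reflection along [v = w - e], with the usual scalar
    [2 / (v^H v)] replaced by [1 / (v^H w)]: then the image of [w] is [w - v = e]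
    even when [w^H e] is not real, and unitarity follows from
    [v^H v = v^H w + w^H v]. *)
Lemma householder n (w e : 'cV[F]_n) : adjmx w *m w = 1%:M -> adjmx e *m e = 1%:M ->
  exists H : 'M_n, [/\ adjmx H *m H = 1%:M, H *m adjmx H = 1%:M & H *m w = e].
Proof.
move=> ww ee; pose v := w - e; pose d := (adjmx v *m w) 0 0.
have vw : adjmx v *m w = d%:M by rewrite [LHS]mx11_scalar.
have wv : adjmx w *m v = (conj d)%:M.
  by rewrite -[adjmx w *m v]adjmxK adjmxM adjmxK vw /adjmx tr_scalar_mx map_scalar_mx.
have vv : adjmx v *m v = (d + conj d)%:M.
  transitivity (adjmx v *m w + adjmx w *m v).
    rewrite adjmxB !mulmxBl !mulmxBr ww ee.
    move: (adjmx w *m e) (adjmx e *m w) => a b.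
    by apply/matrixP => i j; rewrite !mxE; ring.
  by rewrite vw wv; apply/matrixP => i j; rewrite !mxE mulrnDl.
(* [d = 0] forces [v^H v = 0], that is [w = e]. *)
have [d0|d0] := eqVneq d 0.
  exists 1%:M; rewrite adjmx1 !mul1mx; split=> //.
  have [r [_ hr rv]] := adj_mul_self v.
  apply/eqP; rewrite -subr_eq0; apply/eqP/rv/eqP; rewrite -(fmorph_eq0 of_real).
  move/matrixP/(_ 0 0): hr; rewrite vv d0 rmorph0 addr0 !mxE eqxx !mulr1n => /esym/eqP.
  exact.
have cd0 : conj d != 0 by rewrite fmorph_eq0.
pose H : 'M_n := 1%:M - d^-1 *: (v *m adjmx v).
have adjH : adjmx H = 1%:M - (conj d)^-1 *: (v *m adjmx v).
  by rewrite adjmxB adjmx1 adjmxZ adjmxM adjmxK fmorphV.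
have HH : adjmx H *m H = 1%:M.
  rewrite adjH mulmxBl mul1mx mulmxBr mulmx1 -scalemxAl -scalemxAr.
  rewrite mulmxA -(mulmxA v (adjmx v) v) vv mul_mx_scalar -scalemxAl.
  rewrite /H; move: (v *m adjmx v) => M.
  apply/matrixP => i j; rewrite !mxE.
  exact: householder_entry.
exists H; split=> //; first exact: mulmx1C.
by rewrite mulmxBl mul1mx -scalemxAl -mulmxA vw mul_mx_scalar scalerA mulVf // scale1r
  opprB addrC subrK.
Qed.

(** The unitary matrix that [householder] supplies to map [w] to the first basis
    vector has [w] as the first column of its adjoint; [V] consists of the other
    columns. *)
Lemma unit_completion m (w : 'cV[F]_m) : adjmx w *m w = 1%:M ->
  exists p (V : 'M_(m, p)),
    [/\ adjmx V *m V = 1%:M, w *m adjmx w + V *m adjmx V = 1%:M,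
        adjmx V *m w = 0, adjmx w *m V = 0 & (1 + p = m)%N].
Proof.
case: m w => [|p] w ww.
  have /matrixP/(_ 0 0) := ww; rewrite !mxE big_ord0 eqxx => /eqP.
  by rewrite eq_sym oner_eq0.
pose e : 'cV[F]_(1 + p) := col_mx 1%:M 0.
have ee : adjmx e *m e = 1%:M.
  by rewrite adj_col_mx mul_row_col mulmx0 addr0 adjmx1 mul1mx.
have [H [HH HH' Hw]] := @householder (1 + p) w e ww ee.
have := @hsubmxK _ (1 + p) 1 p (adjmx H); move: (lsubmx _) (rsubmx _) => w' V Hrow.
have Hcol : col_mx (adjmx w') (adjmx V) = H by rewrite -[RHS]adjmxK -Hrow adj_row_mx.
have ew : w' = w.
  rewrite -[RHS](@mul1mx _ (1 + p)) -HH -mulmxA Hw -Hrow.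
  by rewrite mul_row_col mulmx1 mulmx0 addr0.
move: HH' HH; rewrite -Hrow -Hcol mul_col_row mul_row_col scalar_mx_block ew.
by move=> /eq_block_mx[_ h2 h3 h4] h1; exists p, V.
Qed.

(** Multiplying [a y = b z] by [y^H] gives [a (y^H y) = b (y^H z)], and [y^H z]
    is real by symmetry; so [a] and [b] can be replaced by the real numbers
    [y^H z] and [y^H y] unless [y = 0]. *)
Lemma proportional_real_ratio m (y z : 'cV[F]_m) (a b : F) :
  adjmx y *m z = adjmx z *m y -> (a != 0) || (b != 0) -> a *: y = b *: z ->
  exists e q : R, e ^+ 2 + q ^+ 2 = 1 /\ of_real q *: y = of_real e *: z.
Proof.
move=> hyz ab hab.
have [r [r_ge0 hr ry]] := adj_mul_self y.
have [r0|r0] := eqVneq r 0.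
  exists 0, 1; rewrite (ry r0) expr1n expr0n add0r scaler0 rmorph0 scale0r.
  by split.
have b0 : b != 0.
  apply: contra r0 => /eqP b0; move: ab hab; rewrite b0 eqxx orbF scale0r.
  move=> a0 /eqP; rewrite scaler_eq0 (negPf a0) /= => /eqP y0.
  by rewrite -(fmorph_eq0 of_real); move/matrixP/(_ 0 0): hr;
    rewrite y0 mulmx0 !mxE eqxx mulr1n => /esym/eqP.
have [t ht] : exists t, (adjmx y *m z) 0 0 = of_real t.
  apply: conj_id_real.
  have -> : conj ((adjmx y *m z) 0 0) = adjmx (adjmx y *m z) 0 0 by rewrite !mxE.
  by rewrite adjmxM adjmxK hyz.
have yz : adjmx y *m z = (of_real t)%:M by rewrite [LHS]mx11_scalar ht.
have abr : a * of_real r = b * of_real t.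
  have /matrixP/(_ 0 0) : a *: (adjmx y *m y) = b *: (adjmx y *m z).
    by rewrite [LHS]scalemxAr [RHS]scalemxAr; congr (_ *m _); exact: hab.
  by rewrite hr yz !mxE !mulr1n.
have hty : of_real t *: y = of_real r *: z.
  apply: (scalerI b0); rewrite !scalerA -abr.
  transitivity (of_real r *: (a *: y)); first by rewrite scalerA mulrC.
  by rewrite hab scalerA mulrC.
pose s := Num.sqrt (r ^+ 2 + t ^+ 2).
have ss : s ^+ 2 = r ^+ 2 + t ^+ 2 by rewrite sqr_sqrtr // addr_ge0 ?sqr_ge0.
have s0 : s != 0.
  rewrite -sqrf_eq0 ss paddr_eq0 ?sqr_ge0 // negb_and sqrf_eq0 r0 //.
exists (r / s), (t / s); split.
  by rewrite !exprMn -mulrDl -ss exprVn mulfV // sqrf_eq0.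
by rewrite !rmorphM /= ![of_real _ * of_real s^-1]mulrC -!scalerA hty.
Qed.

End Ground.

(** * Splitting off kernel vectors and real eigenpairs *)

Fact unit_combination (K : comNzRingType) (V : lmodType K) (a b : K) (y z : V) :
  a * a + b * b = 1 -> b *: y = a *: z ->
  y = a *: (a *: y + b *: z) /\ z = b *: (a *: y + b *: z).
Proof.
move=> h yz; rewrite !scalerDr; split.
  rewrite [a *: (b *: z)]scalerA mulrC -[(b * a) *: z]scalerA -yz !scalerA -scalerDl h.
  by rewrite scale1r.
rewrite [b *: (a *: y)]scalerA mulrC -[(a * b) *: y]scalerA yz !scalerA -scalerDl h.
by rewrite scale1r.
Qed.

Section Splitting.
Variables (R : realType) (k : ground).
Local Notation F := (ground_field R k).
Local Notation conj := (@conj_ground R k).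
Local Notation of_real := (@ground_of_real R k).
Implicit Types (m n p : nat).

Lemma adjmx_toC m n (A : 'M[F]_(m, n)) :
  @adjmx R ComplexGround _ _ (map_mx (@toC R k) A) = map_mx (@toC R k) (adjmx A).
Proof. by apply/matrixP => i j; rewrite !mxE toC_conj. Qed.

(** A complex eigenvector belongs to a real eigenvalue by
    [proportional_real_ratio]; the corresponding real combination of [E] and [Q]
    then has a nontrivial kernel over the ground field too, since a left inverse
    over the ground field would remain one over the complex numbers. *)
Lemma no_real_eigenpair m n (E Q : 'M[F]_(m, n)) :
  adjmx E *m Q = adjmx Q *m E ->
  (forall (e q : R) (x : 'cV[F]_n), e ^+ 2 + q ^+ 2 = 1 ->
     of_real q *: (E *m x) = of_real e *: (Q *m x) -> x = 0) ->
  no_eigenpair (map_mx (@toC R k) E) (map_mx (@toC R k) Q).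
Proof.
move=> EQ noreal a b x ab hx.
have [|e [q [eq1 heq]]] :=
    @proportional_real_ratio R ComplexGround _ (map_mx (@toC R k) E *m x)
      (map_mx (@toC R k) Q *m x) a b _ ab hx.
  rewrite !adjmxM !adjmx_toC -!mulmxA; congr (_ *m _); rewrite !mulmxA.
  by rewrite -(map_mxM (@toC R k)) EQ map_mxM.
have inj : col_inj (of_real q *: E - of_real e *: Q).
  move=> y /eqP; rewrite mulmxBl subr_eq0 -!scalemxAl => /eqP; exact: noreal.
have [L hL] := (col_injP _).1 inj.
rewrite -[x]mul1mx -(map_mx1 (@toC R k)) -hL map_mxM -mulmxA map_mxB !map_mxZ.
rewrite mulmxBl -!scalemxAl /= !toC_of_real.
have /eqP := heq; rewrite -subr_eq0 => /eqP heq0.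
by transitivity (map_mx (@toC R k) L *m 0 : 'cV_n); [congr (_ *m _) | exact: mulmx0].
Qed.

(** A sign condition on the pairs of diagonal entries of the regular part.  It is
    a parameter because making the entries of [Q] nonnegative and making those of
    [E] nonnegative are two different normalizations of the same induction. *)
Variable good : R -> R -> Prop.

(** The condensed form with zero upper right blocks, kept as separate column
    blocks [U1], [U2] of the inverse of the unitary factor and [X1], [X2], [X3]
    of the nonsingular one (with row blocks [Y1], [Y2], [Y3] of its inverse), so
    that an induction can enlarge one block without reassociating the others. *)
Variant splitting m n (E Q : 'M[F]_(m, n)) : Prop :=
  Splitting n1 m2 n2 r (U1 : 'M_(m, n1)) (U2 : 'M_(m, m2))
    (X1 : 'M_(n, n1)) (X2 : 'M_(n, n2)) (X3 : 'M_(n, r))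
    (Y1 : 'M_(n1, n)) (Y2 : 'M_(n2, n)) (Y3 : 'M_(r, n))
    (e q : 'rV[R]_n1) (E22 Q22 : 'M_(m2, n2)) of
    [/\ U1 *m adjmx U1 + U2 *m adjmx U2 = 1%:M, (n1 + m2 = m)%N,
        X1 *m Y1 + X2 *m Y2 + X3 *m Y3 = 1%:M & (n1 + n2 + r = n)%N] &
    [/\ E *m X1 = U1 *m diag_mx (map_mx of_real e), E *m X2 = U2 *m E22 &
        E *m X3 = 0] &
    [/\ Q *m X1 = U1 *m diag_mx (map_mx of_real q), Q *m X2 = U2 *m Q22 &
        Q *m X3 = 0] &
    no_eigenpair (map_mx (@toC R k) E22) (map_mx (@toC R k) Q22) &
    forall i, e 0 i ^+ 2 + q 0 i ^+ 2 = 1 /\ good (e 0 i) (q 0 i).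

Lemma splitting_no_eigenpair m n (E Q : 'M[F]_(m, n)) :
  no_eigenpair (map_mx (@toC R k) E) (map_mx (@toC R k) Q) -> splitting E Q.
Proof.
move=> noeig.
apply: (@Splitting m n E Q 0 m n 0 0 1%:M 0 1%:M 0 0 1%:M 0 0 0 E Q) => //.
- by split; rewrite ?mul0mx ?adjmx1 ?mulmx1 ?add0r ?addr0 ?addn0.
- by split; rewrite ?mulmx1 ?mul1mx ?mul0mx ?mulmx0.
- by split; rewrite ?mulmx1 ?mul1mx ?mul0mx ?mulmx0.
- by case.
Qed.

Lemma splitting_kernel m n p (E Q : 'M[F]_(m, n)) (x : 'cV_n) (f : 'rV_n)
    (Y : 'M_(n, p)) (g : 'M_(p, n)) :
  x *m f + Y *m g = 1%:M -> (1 + p = n)%N -> E *m x = 0 -> Q *m x = 0 ->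
  splitting (E *m Y) (Q *m Y) -> splitting E Q.
Proof.
move=> dec dim Ex Qx [n1 m2 n2 r U1 U2 X1 X2 X3 Y1 Y2 Y3 e q E22 Q22].
move=> [UU du XX dx] [E1 E2 E3] [Q1 Q2 Q3] noeig hgood.
apply: (@Splitting m n E Q n1 m2 n2 (1 + r) U1 U2 (Y *m X1) (Y *m X2)
  (row_mx x (Y *m X3)) (Y1 *m g) (Y2 *m g) (col_mx f (Y3 *m g)) e q E22 Q22) => //.
- split=> //; last by lia.
  transitivity (x *m f + Y *m (1%:M *m g)); last by rewrite mul1mx.
  rewrite -XX mul_row_col !mulmxDl !mulmxDr !mulmxA.
  by rewrite addrCA !addrA.
- by rewrite !mulmxA E1 E2 mul_mx_row mulmxA Ex E3 row_mx0.
- by rewrite !mulmxA Q1 Q2 mul_mx_row mulmxA Qx Q3 row_mx0.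
Qed.

(** The eigenvector [x] splits off from both sides: [f] is a common multiple of
    the rows [w^H E] and [w^H Q], hence on its kernel [E] and [Q] take values
    orthogonal to [w]. *)
Lemma splitting_eigenpair m n p p' (E Q : 'M[F]_(m, n)) (x : 'cV_n) (f : 'rV_n)
    (Y : 'M_(n, p)) (g : 'M_(p, n)) (w : 'cV_m) (V : 'M_(m, p')) (e0 q0 : R) :
  x *m f + Y *m g = 1%:M -> (1 + p = n)%N -> f *m Y = 0 ->
  w *m adjmx w + V *m adjmx V = 1%:M -> (1 + p' = m)%N ->
  E *m x = of_real e0 *: w -> Q *m x = of_real q0 *: w ->
  adjmx w *m E = of_real e0 *: f -> adjmx w *m Q = of_real q0 *: f ->
  e0 ^+ 2 + q0 ^+ 2 = 1 -> good e0 q0 ->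
  splitting (adjmx V *m E *m Y) (adjmx V *m Q *m Y) -> splitting E Q.
Proof.
move=> dec dim fY decV dimV Ex Qx wE wQ eq1 geq.
move=> [n1 m2 n2 r U1 U2 X1 X2 X3 Y1 Y2 Y3 e q E22 Q22].
move=> [UU du XX dx] [E1 E2 E3] [Q1 Q2 Q3] noeig hgood.
have VV (A : 'M[F]_(m, n)) (c : F) : adjmx w *m A = c *: f ->
    A *m Y = V *m (adjmx V *m A *m Y).
  move=> hA; rewrite -[LHS]mul1mx -decV mulmxDl -mulmxA (mulmxA _ A) hA.
  by rewrite -scalemxAl fY scaler0 mulmx0 add0r !mulmxA.
have EY := VV _ _ wE; have QY := VV _ _ wQ.
have diag1 (c : R) : diag_mx (map_mx of_real (c%:M : 'M_1)) = (of_real c)%:M.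
  by apply/matrixP => i j; rewrite !ord1 !mxE.
apply: (@Splitting m n E Q (1 + n1) m2 n2 r (row_mx w (V *m U1)) (V *m U2)
  (row_mx x (Y *m X1)) (Y *m X2) (Y *m X3) (col_mx f (Y1 *m g)) (Y2 *m g) (Y3 *m g)
  (row_mx e0%:M e) (row_mx q0%:M q) E22 Q22) => //.
- split; [|by lia| |by lia].
    transitivity (w *m adjmx w + V *m (1%:M *m adjmx V)); last by rewrite mul1mx.
    by rewrite -UU adj_row_mx mul_row_col !adjmxM mulmxDl mulmxDr !mulmxA addrA.
  transitivity (x *m f + Y *m (1%:M *m g)); last by rewrite mul1mx.
  rewrite -XX mul_row_col !mulmxDl !mulmxDr !mulmxA.
  by rewrite !addrA.
- split; last by rewrite mulmxA EY -mulmxA E3 mulmx0.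
    rewrite map_row_mx diag_mx_row diag1 mul_mx_row Ex mulmxA EY -mulmxA E1.
    by rewrite mul_row_block !mulmx0 addr0 add0r mul_mx_scalar !mulmxA.
  by rewrite mulmxA EY -mulmxA E2 mulmxA.
- split; last by rewrite mulmxA QY -mulmxA Q3 mulmx0.
    rewrite map_row_mx diag_mx_row diag1 mul_mx_row Qx mulmxA QY -mulmxA Q1.
    by rewrite mul_row_block !mulmx0 addr0 add0r mul_mx_scalar !mulmxA.
  by rewrite mulmxA QY -mulmxA Q2 mulmxA.
- move=> i; case: (split_ordP i) => j ->; rewrite ?row_mxEl ?row_mxEr //.
  by rewrite ord1 !mxE eqxx !mulr1n.
Qed.

(** Replacing the left direction [w] by [- w] changes both signs. *)
Hypothesis good_sign : forall e q : R, e ^+ 2 + q ^+ 2 = 1 -> good e q \/ good (- e) (- q).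

(** Each real eigenpair [q E x = e Q x] is split off, either as a zero column or
    as a one by one regular block; when none is left, no complex eigenpair is
    left either.  Hermitian symmetry provides the left counterpart
    [q w^H E = e w^H Q] of the eigenvector equation. *)
Lemma hermitian_splitting m n (E Q : 'M[F]_(m, n)) :
  adjmx E *m Q = adjmx Q *m E -> splitting E Q.
Proof.
elim: {n}_.+1 {-2}n (ltnSn n) m E Q => // N IH n ltnN m E Q EQ.
have [noreal|] := pselect (forall (e q : R) (x : 'cV[F]_n), e ^+ 2 + q ^+ 2 = 1 ->
     of_real q *: (E *m x) = of_real e *: (Q *m x) -> x = 0).
  exact/splitting_no_eigenpair/no_real_eigenpair.
move=> /existsNP[e] /existsNP[q] /existsNP[x] /not_implyP[eq1] /not_implyP[hx x0].
wlog geq : e q eq1 hx / good e q.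
  move=> wl; case: (good_sign eq1) => h; first exact: (wl e q).
  by apply: (wl (- e) (- q)); rewrite ?sqrrN // !rmorphN !scaleNr hx.
pose w := of_real e *: (E *m x) + of_real q *: (Q *m x).
have eq1F : of_real e * of_real e + of_real q * of_real q = 1.
  by rewrite -!rmorphM -rmorphD -!expr2 eq1 rmorph1.
have [Ew Qw] : E *m x = of_real e *: w /\ Q *m x = of_real q *: w :=
  unit_combination eq1F hx.
have EQw : of_real q *: (adjmx w *m E) = of_real e *: (adjmx w *m Q).
  have : adjmx (E *m x) *m Q = adjmx (Q *m x) *m E.
    by rewrite !adjmxM -!mulmxA EQ.
  by rewrite Ew Qw !adjmxZ !conj_of_real -!scalemxAl => ->.
have [r [r_ge0 hr rw]] := adj_mul_self w.
have [r0|r0] := eqVneq r 0.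
  have w0 := rw r0.
  have [f fx] : exists f : 'rV[F]_n, f *m x = 1%:M.
    have [i /eqP xi] : exists i, x i 0 <> 0.
      apply/existsNP => h; apply: x0; apply/matrixP => i j.
      by rewrite ord1 h mxE.
    exists ((x i 0)^-1 *: delta_mx 0 i); rewrite -scalemxAl -rowE.
    by apply/matrixP => a b; rewrite !ord1 !mxE mulVf.
  have [d [Y [g [dec _ _ _ dim]]]] := split_complement fx.
  apply: (splitting_kernel dec dim); rewrite ?Ew ?Qw ?w0 ?scaler0 //.
  apply: IH; first by lia.
  by rewrite !adjmxM -!mulmxA (mulmxA _ Q) EQ -!mulmxA.
pose c := of_real (Num.sqrt r)^-1.
pose u := c *: w.
have uu : adjmx u *m u = 1%:M.
  rewrite adjmxZ -scalemxAl -scalemxAr hr conj_of_real scalerA.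
  rewrite scale_scalar_mx -!rmorphM -invfM -expr2 sqr_sqrtr // mulVf // rmorph1 //.
have [p' [V [_ decV _ _ dimV]]] := unit_completion uu.
pose f := of_real e *: (adjmx u *m E) + of_real q *: (adjmx u *m Q).
have EQu : of_real q *: (adjmx u *m E) = of_real e *: (adjmx u *m Q).
  by rewrite adjmxZ -!scalemxAl !scalerA ![_ * conj _]mulrC -!scalerA EQw.
have [uE uQ] : adjmx u *m E = of_real e *: f /\ adjmx u *m Q = of_real q *: f :=
  unit_combination eq1F EQu.
pose y := c *: x.
have Ey : E *m y = of_real e *: u by rewrite -scalemxAr Ew !scalerA mulrC.
have Qy : Q *m y = of_real q *: u by rewrite -scalemxAr Qw !scalerA mulrC.
have fy : f *m y = 1%:M.
  rewrite mulmxDl -!scalemxAl -!mulmxA Ey Qy; move: (u) uu => v vv.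
  by rewrite -!scalemxAr vv !scalerA -scalerDl eq1F scale1r.
have [d [Y [g [dec _ fY _ dim]]]] := split_complement fy.
apply: (splitting_eigenpair dec dim fY decV dimV Ey Qy uE uQ eq1 geq).
apply: IH; first by lia.
have VV : V *m adjmx V = 1%:M - u *m adjmx u by rewrite -decV addrC addKr.
rewrite !adjmxM adjmxK -!mulmxA.
have red (A B : 'M[F]_(m, n)) (b : F) : adjmx u *m B = b *: f ->
    adjmx Y *m (adjmx A *m (V *m (adjmx V *m (B *m Y)))) =
    adjmx Y *m (adjmx A *m B *m Y).
  move=> hB; rewrite (mulmxA V) VV mulmxBl mul1mx -(mulmxA u) (mulmxA _ B) hB.
  by rewrite -scalemxAl fY scaler0 mulmx0 subr0 !mulmxA.
by rewrite (red _ _ _ uQ) (red _ _ _ uE) EQ.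
Qed.

End Splitting.

(** * The condensed form *)

Lemma kronecker_1x1 (K : fieldType) (e q : K) : (e != 0) || (q != 0) ->
  exists2 b, is_regular_block b & kronecker [:: b] (e%:M : 'M_1) (q%:M : 'M_1).
Proof.
have iso (c : K) : c != 0 -> iso_mx (c%:M : 'M_1).
  by move=> c0; exists (c^-1)%:M; rewrite -!scalar_mxM mulfV ?mulVf.
have [->|e0 _] := eqVneq e 0.
  move=> /= q0; exists (InfBlock 0) => //.
  apply: pencil_equiv_trans (kronecker_block _) => /=.
  exists q%:M, 1%:M; split; [exact: iso | exact: iso_mx1 | |].
    rewrite raddf0 mul0mx; apply/matrixP => i j.
    by rewrite !mxE big_ord1 !mxE !ord1 mul0rn addr0 mulr0.
  by rewrite mulmx1.
exists (JordanBlock (q / e) 0) => //.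
apply: pencil_equiv_trans (kronecker_block _) => /=.
exists e%:M, 1%:M; split; [exact: iso | exact: iso_mx1 | by rewrite mulmx1 |].
rewrite mulmx1; apply/matrixP => i j.
by rewrite !mxE big_ord1 !mxE !ord1 /= !mulr1n addr0 mulrC divfK.
Qed.

Lemma kronecker_diag (K : fieldType) n (e q : 'rV[K]_n) :
  (forall i, (e 0 i != 0) || (q 0 i != 0)) ->
  exists2 s, all (@is_regular_block _) s & kronecker s (diag_mx e) (diag_mx q).
Proof.
elim: n e q => [|n IH] e q.
  move=> _; exists [::] => //=.
  by exists 1%:M, 1%:M; split; try exact: iso_mx1; apply/matrixP => -[].
rewrite -[e](@hsubmxK _ 1 1 n) -[q](@hsubmxK _ 1 1 n).
move: (lsubmx _) (rsubmx _) (lsubmx _) (rsubmx _) => q0 q' e0 e' eq0'.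
have eq0 (i : 'I_(1 + n)) : (row_mx e0 e' 0 i != 0) || (row_mx q0 q' 0 i != 0) := eq0' i.
have [|b hb kb] := @kronecker_1x1 K (e0 0 0) (q0 0 0).
  by have := eq0 (lshift n 0); rewrite !row_mxEl.
have [|s hs ks] := IH e' q'.
  by move=> i; have := eq0 (rshift 1 i); rewrite !row_mxEr.
exists (b :: s); first by rewrite /= hb.
have := kronecker_cat kb ks.
have diag1 (c : 'rV[K]_1) : diag_mx c = (c 0 0)%:M.
  by apply/matrixP => i j; rewrite !ord1 !mxE.
have hrow (c : 'rV[K]_1) (d : 'rV_n) : diag_mx (row_mx c d : 'rV_(1 + n)) =
  block_mx (c 0 0)%:M 0 0 (diag_mx d) by rewrite diag_mx_row diag1.
rewrite /kronecker /=.
by rewrite -!hrow.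
Qed.

Section Assembly.
Variables (R : realType) (k : ground).
Local Notation F := (ground_field R k).
Local Notation of_real := (@ground_of_real R k).
Implicit Types (m n p : nat).

Lemma kronecker_kcf m n (A B : 'M[F]_(m, n)) s :
  kronecker s (map_mx (@toC R k) A) (map_mx (@toC R k) B) -> has_kcf A B s.
Proof. exact: kronecker_is_kcf. Qed.

Lemma staircase_diag m n1 n2 m2 n r (A : 'M[F]_(m, n)) (U1 : 'M_(m, n1)) (U2 : 'M_(m, m2))
    (X1 : 'M_(n, n1)) (X2 : 'M_(n, n2)) (X3 : 'M_(n, r)) (A11 : 'M_n1) (A22 : 'M_(m2, n2)) :
  A *m X1 = U1 *m A11 -> A *m X2 = U2 *m A22 -> A *m X3 = 0 ->
  A *m row_mx (row_mx X1 X2) X3 = row_mx U1 U2 *m staircase_mx r A11 0 A22.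
Proof.
move=> h1 h2 h3; rewrite /staircase_mx !mul_mx_row mul_row_block h1 h2 h3.
by rewrite !mulmx0 addr0 add0r.
Qed.

(** Since the upper right blocks vanish, the condensed form is itself the
    direct sum that determines the Kronecker form.  Positivity of the products
    [e q] comes from the congruence
    [X1^H (E^H Q) X1 = E11^H U1^H U1 Q11 = E11 Q11]. *)
Lemma condensed_of_splitting (good : R -> R -> Prop) m n (E Q : 'M[F]_(m, n)) :
  splitting good E Q ->
  has_condensed_form E Q (fun n1 E11 Q11 => exists e q : 'rV[R]_n1,
    [/\ E11 = diag_mx (map_mx of_real e), Q11 = diag_mx (map_mx of_real q),
        forall i, good (e 0 i) (q 0 i) &
        psdmx (adjmx E *m Q) -> forall i, 0 <= e 0 i * q 0 i]).
Proof.
case=> n1 m2 n2 r U1 U2 X1 X2 X3 Y1 Y2 Y3 e q E22 Q22.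
move=> [UU em XX en] [E1 E2 E3] [Q1 Q2 Q3] noeig hgood.
pose W := row_mx U1 U2; pose X := row_mx (row_mx X1 X2) X3.
pose Y := col_mx (col_mx Y1 Y2) Y3.
set E11 := diag_mx (map_mx of_real e) in E1; set Q11 := diag_mx (map_mx of_real q) in Q1.
have EX := staircase_diag E1 E2 E3; have QX := staircase_diag Q1 Q2 Q3.
have WW : W *m adjmx W = 1%:M by rewrite adj_row_mx mul_row_col.
have XY : X *m Y = 1%:M by rewrite !mul_row_col.
subst m n.
have WW' : adjmx W *m W = 1%:M by apply: mulmx1C.
have YX : Y *m X = 1%:M by apply: mulmx1C.
have U11 : adjmx U1 *m U1 = 1%:M.
  move: WW'; rewrite adj_row_mx mul_col_row scalar_mx_block => /eq_block_mx.
  by case.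
have eq2 i : e 0 i ^+ 2 + q 0 i ^+ 2 = 1 by have [] := hgood i.
have [s1 reg1 k1] : exists2 s, all (@is_regular_block _) s &
    kronecker s (map_mx (@toC R k) E11) (map_mx (@toC R k) Q11).
  rewrite !map_diag_mx; apply: kronecker_diag => i; rewrite !mxE !fmorph_eq0.
  apply/negPn; rewrite negb_or !negbK; apply/negP => /andP[/eqP e0 /eqP q0].
  by have /eqP := eq2 i; rewrite e0 q0 expr0n addr0 eq_sym oner_eq0.
have [s k22] := no_eigenpair_left_blocks noeig.
pose K22 : seq (kblock R[i]) := [seq LeftBlock a | a <- s].
pose K : seq (kblock R[i]) := s1 ++ K22 ++ nseq r (RightBlock 0).
have kst : kronecker K (map_mx (@toC R k) (staircase_mx r E11 0 E22))
                       (map_mx (@toC R k) (staircase_mx r Q11 0 Q22)).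
  rewrite /staircase_mx !map_row_mx !map_block_mx !map_mx0 /K catA.
  exact/kronecker_row0/kronecker_cat.
have kEQ : kronecker K (map_mx (@toC R k) E) (map_mx (@toC R k) Q).
  apply: pencil_equiv_trans kst.
  exists (map_mx (@toC R k) W), (map_mx (@toC R k) X); split.
  - by exists (map_mx (@toC R k) (adjmx W)); rewrite -!map_mxM WW WW' !map_mx1.
  - by exists (map_mx (@toC R k) Y); rewrite -!map_mxM XY YX !map_mx1.
  - by rewrite -!map_mxM EX.
  - by rewrite -!map_mxM QX.
have left1 : left_indices s1 = [::].
  by elim: {k1 K kst kEQ} s1 reg1 => //= -[] //= ? s' IH; apply: IH.
have right1 : right_indices s1 = [::].
  by elim: {k1 K kst kEQ left1} s1 reg1 => //= -[] //= ? s' IH; apply: IH.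
have left3 : left_indices (nseq r (RightBlock 0) : seq (kblock R[i])) = [::].
  by elim: (r).
have right2 : right_indices K22 = [::] by rewrite /K22; elim: (s).
have right3 : right_indices (nseq r (RightBlock 0) : seq (kblock R[i])) = nseq r 0%N.
  by elim: (r) => //= r' ->.
exists n1, m2, n2, r, erefl, erefl, (adjmx W), X, E11, Q11, 0, 0, E22, Q22.
split.
  have diag_real (d : 'rV[R]_n1) : real_diagmx (diag_mx (map_mx of_real d)).
    split; first exact: diag_mx_is_diag.
    by move=> i; rewrite !mxE eqxx mulr1n of_real_real.
  split=> //.
  - by rewrite /unitary adjmxK.
  - by case: (mulmx1_unit XY).
  - by rewrite castmx_id -mulmxA EX mulmxA WW' mul1mx.
  - by rewrite castmx_id -mulmxA QX mulmxA WW' mul1mx.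
  - split; try exact: diag_real.
    rewrite !mulmx_diag; apply/matrixP => i j; rewrite !mxE -mulrnDl.
    by rewrite -!rmorphM -rmorphD -!expr2 eq2 rmorph1.
  - have [er [ec _]] := kronecker_is_kcf k22.
    (* Each left block has one row more than it has columns. *)
    have size_left : m2 = (n2 + size s)%N.
      by rewrite -er -ec; elim: (s) => //= a s' ->; lia.
    case: s {k22 K22 K kst kEQ right2} er ec size_left => [|a s'] /= er ec hm.
      by right.
    left; split; first by lia.
    by case=> eqm _; lia.
  - exists K22; split; first exact: kronecker_kcf.
    by rewrite /K22 all_map; apply/allP.
  - by split=> x _; rewrite mul0mx.
  - exists K, K22; split.
    + by split; apply: kronecker_kcf.
    + rewrite /regular_blocks /K !filter_cat (all_filterP reg1).
      have -> : [seq b <- K22 | is_regular_block b] = [::] by rewrite /K22; elim: (s).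
      have -> : [seq b <- nseq r (RightBlock 0 : kblock R[i]) | is_regular_block b] = [::].
        by elim: (r).
      by rewrite /= cats0; apply: kronecker_kcf.
    + split; first exact: kronecker_kcf.
      have -> : left_indices K = left_indices s1 ++ left_indices K22 ++
          left_indices (nseq r (RightBlock 0 : kblock R[i])).
        by rewrite /left_indices !pmap_cat.
      by rewrite left1 left3 cats0.
    + have -> : right_indices K = right_indices s1 ++ right_indices K22 ++
          right_indices (nseq r (RightBlock 0 : kblock R[i])).
        by rewrite /right_indices !pmap_cat.
      rewrite right1 right2 right3 /=.
      by congr nseq; lia.
exists e, q; split=> // [i|[_ psd] i]; first by have [] := hgood i.
pose x : 'cV[F]_n1 := delta_mx i 0.
have adjx : adjmx x = delta_mx 0 i.
  by apply/matrixP => a b; rewrite !mxE andbC rmorph_nat.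
have adjE : adjmx X1 *m adjmx E = adjmx E11 *m adjmx U1 by rewrite -!adjmxM E1.
have := psd (X1 *m x).
have -> : adjmx (X1 *m x) *m (adjmx E *m Q) *m (X1 *m x) =
    delta_mx 0 i *m (adjmx E11 *m Q11) *m x.
  rewrite adjmxM adjx !mulmxA -(mulmxA (delta_mx 0 i) (adjmx X1)) adjE.
  rewrite -(mulmxA _ Q) Q1 !mulmxA -(mulmxA _ (adjmx U1)) U11 mulmx1.
  by rewrite -!mulmxA.
rewrite -rowE -colE !mxE (bigD1 i) //= big1 ?addr0 => [|j ji]; last first.
  by rewrite !mxE (negPf ji) mulr0n mulr0.
by rewrite !mxE eqxx !mulr1n conj_of_real -rmorphM of_real_ge0.
Qed.

End Assembly.

Lemma has_condensed_form_sub (R : realType) (k : ground) m n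
    (E Q : 'M[ground_field R k]_(m, n))
    (P P' : forall n1, 'M[ground_field R k]_n1 -> 'M[ground_field R k]_n1 -> Prop) :
  (forall n1 E11 Q11, P n1 E11 Q11 -> P' n1 E11 Q11) ->
  has_condensed_form E Q P -> has_condensed_form E Q P'.
Proof.
move=> sub [n1 [m2 [n2 [r [em [en [U [X [E11 [Q11 [E12 [Q12 [E22 [Q22 [h p]]]]]]]]]]]]]]].
exists n1, m2, n2, r, em, en, U, X, E11, Q11, E12, Q12, E22, Q22.
by split=> //; apply: sub.
Qed.

Theorem theorem15 (R : realType) (k : ground) (m n : nat)
    (E Q : 'M[ground_field R k]_(m, n))
    (EQ : adjmx E *m Q = adjmx Q *m E) :
  [/\ has_condensed_form E Q (fun n1 E11 Q11 => True),
      has_condensed_form E Q (fun n1 E11 Q11 => nonneg_diagmx E11),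
      has_condensed_form E Q (fun n1 E11 Q11 => nonneg_diagmx Q11) &
      psdmx (adjmx E *m Q) ->
      has_condensed_form E Q
        (fun n1 E11 Q11 => nonneg_diagmx E11 /\ nonneg_diagmx Q11)].
Proof.
have nonneg n1 (d : 'rV[R]_n1) : (forall i, 0 <= d 0 i) ->
    nonneg_diagmx (diag_mx (map_mx (@ground_of_real R k) d)).
  move=> d_ge0; split; first exact: diag_mx_is_diag.
  by move=> i; rewrite !mxE eqxx mulr1n of_real_ge0.
(* This normalization makes [E11] nonnegative and, where an entry of [E11]
   vanishes, also that of [Q11]; elsewhere the sign of [q] is that of [e q]. *)
pose good (e q : R) : Prop := 0 < e \/ e = 0 /\ 0 <= q.
have Efirst : splitting good E Q.
  apply: hermitian_splitting EQ => e q _; rewrite /good oppr_gt0 oppr_ge0.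
  have [e0|e0|->] := ltgtP e 0; [by right; left | by left; left |].
  by rewrite oppr0; case: (leP 0 q) => [|/ltW] q0; [left | right]; right.
have Qfirst : splitting (fun e q => 0 <= q) E Q.
  apply: hermitian_splitting EQ => e q _; rewrite oppr_ge0.
  by case: (leP 0 q) => [|/ltW]; [left | right].
have good_ge0 e q : good e q -> 0 <= e by case=> [/ltW|[->]].
split.
- by apply: has_condensed_form_sub (condensed_of_splitting Efirst).
- apply: has_condensed_form_sub (condensed_of_splitting Efirst) => n1 E11 Q11.
  by case=> e [q [-> _ h _]]; apply: nonneg => i; apply: good_ge0 (h i).
- apply: has_condensed_form_sub (condensed_of_splitting Qfirst) => n1 E11 Q11.
  by case=> e [q [_ -> h _]]; apply: nonneg.
- move=> psd.
  apply: has_condensed_form_sub (condensed_of_splitting Efirst) => n1 E11 Q11.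
  case=> e [q [-> -> h /(_ psd) eq0]]; split; apply: nonneg => i.
    exact: good_ge0 (h i).
  by have := eq0 i; case: (h i) => [e0|[_ //]]; rewrite pmulr_rge0.
Qed.
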